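(* For an integer $m\ge0$ let $\mathbf{S}_m=\{1,\dots,m\}^2$, and let $A_{\mathbf{S}}(m,k)$ be the number of $k$-element subsets of $\mathbf{S}_m$ such that no two distinct elements $(i,j),(i',j')$ satisfy $i=i'$ or $i-j=i'-j'$ (nonattacking placements of $k$ anassas with moves $(0,1),(1,1)$). Then for all integers $m,k\ge0$, $$A_{\mathbf{S}}(m,k)=\sum_{j=0}^{\lceil k/2\rceil}(m-k+j)_j\left\{ {m \atop m-k+j}\right\}2^{k-2j}\left[\binom{k-j}{j-1}+\binom{k-j+1}{j}\right].$$
   Context: $(x)_j=x(x-1)\cdots(x-j+1)$, $(x)_0=1$. Stirling numbers of the second kind $\left\{ {n \atop r}\right\}$ are used in the extended sense for all integers: usual values for $n,r\ge0$; $\left\{ {n \atop r}\right\}=\left[{-r\atop -n}\right]$ (unsigned Stirling number of the first kind) for $n,r\le0$; and $0$ when one of $n,r$ is positive and the other negative. Binomial coefficients are extended to all integers (Kronenburg's convention): $\binom{n}{r}=n(n-1)\cdots(n-r+1)/r!$ if $r\ge0$; $\binom{n}{r}=(-1)^{n-r}\binom{-r-1}{n-r}$ if $r\le n<0$; $0$ otherwise. *)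

(* Defs.v *)
From HB Require Import structures.
From mathcomp Require Import all_boot all_order all_algebra.
Set Implicit Arguments. Unset Strict Implicit. Unset Printing Implicit Defensive.
Import Order.TTheory GRing.Theory Num.Theory.
Local Open Scope ring_scope.

Definition ffact (x : rat) (j : nat) : rat := \prod_(i < j) (x - i%:R).

Fixpoint stirling2 (n k : nat) : nat :=
  match n, k with
  | 0, 0 => 1
  | 0, _.+1 => 0
  | _.+1, 0 => 0
  | n'.+1, k'.+1 => (k'.+1 * stirling2 n' k'.+1 + stirling2 n' k')%N
  end.

Fixpoint stirling1 (n k : nat) : nat :=
  match n, k with
  | 0, 0 => 1
  | 0, _.+1 => 0
  | _.+1, 0 => 0
  | n'.+1, k'.+1 => (n' * stirling1 n' k'.+1 + stirling1 n' k')%N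
  end.

Definition stirling2Z (n r : int) : rat :=
  if (0 <= n) && (0 <= r) then (stirling2 `|n|%N `|r|%N)%:R
  else if (n <= 0) && (r <= 0) then (stirling1 `|r|%N `|n|%N)%:R
  else 0.

(* extended binomial coefficients (Kronenburg's convention) *)
Definition binomZ (n r : int) : rat :=
  if 0 <= r then ffact n%:~R `|r|%N / (`|r|`!)%:R
  else if (r <= n) && (n < 0) then
    (-1) ^+ `|n - r|%N * (ffact (- r - 1)%:~R `|n - r|%N / (`|n - r|`!)%:R)
  else 0.

(* k-element subsets of {1..m}^2 (encoded as 'I_m * 'I_m, i.e. shifted by 1)
   with no two distinct elements in the same row (i = i')
   or on the same diagonal (i - j = i' - j'). *)
Definition nonattacking (m : nat) (P : {set 'I_m * 'I_m}) : bool :=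
  [forall x in P, forall y in P, (x != y) ==>
     ((x.1 != y.1) && ((x.1%:Z - x.2%:Z) != (y.1%:Z - y.2%:Z)))].

Definition AS (m k : nat) : nat :=
  #|[set P : {set 'I_m * 'I_m} | (#|P| == k) && nonattacking P]|.

(* Main.v *)
Require Import Defs.
From HB Require Import structures.
From mathcomp Require Import all_boot all_order all_algebra.
From mathcomp Require Import ring lra zify.
Set Implicit Arguments. Unset Strict Implicit. Unset Printing Implicit Defensive.
Import Order.TTheory GRing.Theory Num.Theory.
Local Open Scope ring_scope.

(** A row [i] meets the diagonals [i - j >= 0] (side L) and [i - j < 0] (side R).
    Recording for each row the side of its piece, or N if it is empty, turns a
    placement into a word.  On each side the sets of diagonals met by the rows are
    nested, so the placements with a given word are counted by a product of weights.
    Let V(m,k) be the sum of these products over words of length m with k letters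
    other than N.  Deleting the first or the last letter gives two expressions for
    V(m+1,k) involving also the sum weighted by the number of letters L; added
    together, they eliminate that sum and give
      2 V(m+1,k) = 2 V(m,k) + (4m-3k+5) V(m,k-1) + (2m-k+3)(m-k+2) V(m,k-2).
    Expanding q! S(m+1,q) = q (q! S(m,q) + (q-1)! S(m,q-1)) shows that the
    right-hand side of the theorem satisfies the same recurrence: what remains is a
    recurrence in c for the coefficients of (1+y)^p (1+2y). *)

(** * Weighted words *)

(* The sum of the weights of the words of length [m] with [l] letters L, [r]
   letters R and [m - l - r] letters N, where an L weighs [x] plus the number of
   earlier letters other than L, and an R weighs [y] plus the number of later
   letters other than R.  The recursion removes the first letter; the parameters
   [x] and [y] stand for full columns added to the two sides of the board. *)
Fixpoint wsum (m l r : nat) (x y : rat) : rat :=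
  if m is m'.+1 then
    wsum m' l r (x + 1) y
    + (if l is l'.+1 then x * wsum m' l' r x y else 0)
    + (if r is r'.+1 then (y + m'%:R - r'%:R) * wsum m' l r' (x + 1) y else 0)
  else ((l == 0%N) && (r == 0%N))%:R.

Lemma wsum_nil l r x y : wsum 0 l r x y = ((l == 0%N) && (r == 0%N))%:R.
Proof. by []. Qed.

Lemma wsum_first m l r x y :
  wsum m.+1 l r x y =
    wsum m l r (x + 1) y
    + (if l is l'.+1 then x * wsum m l' r x y else 0)
    + (if r is r'.+1 then (y + m%:R - r'%:R) * wsum m l r' (x + 1) y else 0).
Proof. by []. Qed.

Arguments wsum : simpl never.

(** The weights are symmetric under reversing the word and exchanging L with R. A last R weighs [y];
    any other last letter adds one to the weight of each R before it. *)
Lemma wsum_last m l r x y :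
  wsum m.+1 l r x y =
    wsum m l r x (y + 1)
    + (if r is r'.+1 then y * wsum m l r' x y else 0)
    + (if l is l'.+1 then (x + m%:R - l'%:R) * wsum m l' r x (y + 1) else 0).
Proof.
elim: m l r x y => [|m IHm] l r x y.
  by rewrite wsum_first; case: l => [|[|l]]; case: r => [|[|r]]; rewrite !wsum_nil /=; ring.
rewrite wsum_first; case: l => [|l]; case: r => [|r];
  rewrite ![in LHS]IHm ![in RHS]wsum_first.
- by ring.
- by case: r => [|r]; ring.
- by case: l => [|l]; ring.
- by case: l => [|l]; case: r => [|r]; ring.
Qed.

(** A new full column on side L either stays empty or holds a piece in one of the [m - l' - r] rows
    left empty by the other pieces. The induction removes the last letter, which keeps [x] fixed. *)
Lemma wsum_diffx m l r x y :
  wsum m l r (x + 1) y = wsum m l r x y +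
    if l is l'.+1 then (m%:R - l'%:R - r%:R) * wsum m l' r x y else 0.
Proof.
elim: m l r x y => [|m IHm] l r x y.
  by case: l => [|[|l]]; case: r => [|r]; rewrite !wsum_nil /=; ring.
rewrite !wsum_last !IHm.
case: l => [|l]; case: r => [|r]; rewrite ?IHm ?wsum_last; try by ring.
- by case: l => [|l]; ring.
- by case: l => [|l]; ring.
Qed.

Lemma wsum_diffy m l r x y :
  wsum m l r x (y + 1) = wsum m l r x y +
    if r is r'.+1 then (m%:R - l%:R - r'%:R) * wsum m l r' x y else 0.
Proof.
elim: m l r x y => [|m IHm] l r x y.
  by case: l => [|l]; case: r => [|[|r]]; rewrite !wsum_nil /=; ring.
rewrite !wsum_first !IHm.
case: l => [|l]; case: r => [|r]; rewrite ?IHm ?wsum_first; try by ring.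
- by case: r => [|r]; ring.
- by case: r => [|r]; ring.
Qed.

Lemma wsum_gt m l r x y : (m < l + r)%N -> wsum m l r x y = 0.
Proof.
elim: m l r x y => [|m IHm] l r x y.
  by case: l => [|l]; case: r.
move=> lt_m; rewrite wsum_first IHm 1?ltnW //.
case: l lt_m => [|l] lt_m; case: r lt_m => [|r] lt_m; rewrite ?IHm ?mulr0 ?addr0 //; lia.
Qed.

Definition vsum m k x y : rat := \sum_(l < k.+1) wsum m l (k - l) x y.
Definition lsum m k x y : rat := \sum_(l < k.+1) l%:R * wsum m l (k - l) x y.

Lemma big_pred_last k (F : nat -> nat -> rat) :
  \sum_(l < k.+2) (if (k.+1 - l)%N is r'.+1 then F l r' else 0)
  = \sum_(l < k.+1) F l (k - l)%N.
Proof.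
rewrite big_ord_recr /= subnn addr0; apply: eq_bigr => l _ /=.
by rewrite subSn // -ltnS.
Qed.

Lemma big_pred_first k (F : nat -> nat -> rat) :
  \sum_(l < k.+2) (if (l : nat) is l'.+1 then F l' (k.+1 - l)%N else 0)
  = \sum_(l < k.+1) F l (k - l)%N.
Proof. by rewrite big_ord_recl /= add0r; apply: eq_bigr. Qed.

(** The factor in [wsum_diffx] depends only on [l' + r = k], so no [lsum] term appears. *)
Lemma vsum_diffx m k x y :
  vsum m k.+1 (x + 1) y = vsum m k.+1 x y + (m%:R - k%:R) * vsum m k x y.
Proof.
rewrite /vsum; under eq_bigr do rewrite wsum_diffx.
rewrite big_split (big_pred_first k (fun l r => (m%:R - l%:R - r%:R) * wsum m l r x y)).
rewrite mulr_sumr; congr (_ + _); apply: eq_bigr => l _.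
by rewrite natrB -1?ltnS //; congr (_ * _); ring.
Qed.

Lemma vsum_diffy m k x y :
  vsum m k.+1 x (y + 1) = vsum m k.+1 x y + (m%:R - k%:R) * vsum m k x y.
Proof.
rewrite /vsum; under eq_bigr do rewrite wsum_diffy.
rewrite big_split (big_pred_last k (fun l r => (m%:R - l%:R - r%:R) * wsum m l r x y)).
rewrite mulr_sumr; congr (_ + _); apply: eq_bigr => l _.
by rewrite natrB -1?ltnS //; congr (_ * _); ring.
Qed.

(** The piece in the new column is an L, so the factor [l] becomes [l + 1], whence the [vsum] term.
    In [lsum_diffy] that piece is an R and the term is absent. *)
Lemma lsum_diffx m k x y :
  lsum m k.+1 (x + 1) y =
  lsum m k.+1 x y + (m%:R - k%:R) * (lsum m k x y + vsum m k x y).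
Proof.
rewrite /lsum /vsum; under eq_bigr do rewrite wsum_diffx mulrDr.
rewrite big_split /=; congr (_ + _).
rewrite -big_split mulr_sumr big_ord_recl mul0r add0r.
apply: eq_bigr => l _; rewrite lift0 subSS natrB -1?ltnS // -natr1 /=; ring.
Qed.

Lemma lsum_diffy m k x y :
  lsum m k.+1 x (y + 1) = lsum m k.+1 x y + (m%:R - k%:R) * lsum m k x y.
Proof.
rewrite /lsum; under eq_bigr do rewrite wsum_diffy mulrDr.
rewrite big_split /=; congr (_ + _).
rewrite big_ord_recr /= subnn mulr0 addr0 mulr_sumr.
apply: eq_bigr => l _; rewrite subSn -1?ltnS //= natrB -1?ltnS //; ring.
Qed.

Lemma lsum0 m x y : lsum m 0 x y = 0.
Proof. by rewrite /lsum big_ord1 mul0r. Qed.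

(** A first R weighs [y + m - r] with [r = k - l], and the summand [l] produces [lsum]. In
    [vsum_last] the weight of a last L produces it with the opposite sign. *)
Lemma vsum_first m k x y :
  vsum m.+1 k.+1 x y = vsum m k.+1 (x + 1) y + x * vsum m k x y
    + (y + m%:R - k%:R) * vsum m k (x + 1) y + lsum m k (x + 1) y.
Proof.
rewrite /vsum /lsum; under eq_bigr do rewrite wsum_first.
rewrite !big_split /= -!addrA; congr (_ + (_ + _)).
  by rewrite (big_pred_first k (fun l r => x * wsum m l r x y)) mulr_sumr.
rewrite (big_pred_last k (fun l r => (y + m%:R - r%:R) * wsum m l r (x + 1) y)).
rewrite mulr_sumr -big_split; apply: eq_bigr => l _ /=.
by rewrite natrB -1?ltnS //; ring.
Qed.

Lemma vsum_last m k x y :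
  vsum m.+1 k.+1 x y = vsum m k.+1 x (y + 1) + y * vsum m k x y
    + (x + m%:R) * vsum m k x (y + 1) - lsum m k x (y + 1).
Proof.
rewrite /vsum /lsum; under eq_bigr do rewrite wsum_last.
rewrite !big_split /= -!addrA; congr (_ + (_ + _)).
  by rewrite (big_pred_last k (fun l r => y * wsum m l r x y)) mulr_sumr.
rewrite (big_pred_first k (fun l r => (x + m%:R - l%:R) * wsum m l r x (y + 1))).
rewrite mulr_sumr -sumrN -big_split; apply: eq_bigr => l _ /=; ring.
Qed.

Lemma vsum_gt m k x y : (m < k)%N -> vsum m k x y = 0.
Proof.
by move=> lt_mk; rewrite /vsum big1 // => l _; rewrite wsum_gt // subnKC // -ltnS.
Qed.

Lemma vsum0 m x y : vsum m 0 x y = 1.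
Proof.
by rewrite /vsum big_ord1; elim: m x => [|m IHm] x; rewrite ?wsum_nil // wsum_first IHm !addr0.
Qed.

Lemma vsum10_rec1 m : 2 * vsum m.+1 1 1 0 = 2 * vsum m 1 1 0 + (4 * m%:R + 2).
Proof.
rewrite mulr_natl mulr2n {1}vsum_first vsum_last vsum_diffx vsum_diffy !vsum0 !lsum0.
ring.
Qed.

(* Average of [vsum_first] and [vsum_last]: the difference of the two [lsum] terms
   collapses by [lsum_diffx] and [lsum_diffy], which leaves only [vsum]. *)
Lemma vsum10_rec m k :
  2 * vsum m.+1 k.+2 1 0 = 2 * vsum m k.+2 1 0
   + (4 * m%:R - 3 * k%:R - 1) * vsum m k.+1 1 0
   + (2 * m%:R - k%:R + 1) * (m%:R - k%:R) * vsum m k 1 0.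
Proof.
rewrite mulr_natl mulr2n {1}vsum_first vsum_last !vsum_diffx !vsum_diffy.
rewrite lsum_diffx lsum_diffy -!natr1; ring.
Qed.

(** * The closed form *)

(* The coefficient of [y^c] in [(1 + y)^p (1 + 2y)]. *)
Definition cbin (p c : nat) : rat :=
  'C(p, c)%:R + 2 * (if c is c'.+1 then 'C(p, c')%:R else 0).

Lemma binS_mul p c :
  c.+1%:R * 'C(p, c.+1)%:R = (p%:R - c%:R) * 'C(p, c)%:R :> rat.
Proof.
rewrite -natrM mul_bin_left natrM.
have [le_cp|lt_pc] := leqP c p; first by rewrite natrB.
by rewrite bin_small // !mulr0.
Qed.

Lemma cbinS p c : cbin p.+1 c.+1 = cbin p c.+1 + cbin p c.
Proof. by rewrite /cbin binS natrD; case: c => [|c]; rewrite ?binS ?natrD ?bin0; ring. Qed.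

Lemma cbin0 p : cbin p 0 = 1.
Proof. by rewrite /cbin bin0; ring. Qed.

Lemma cbin1 p : cbin p 1 = p%:R + 2.
Proof. by rewrite /cbin bin1 bin0; ring. Qed.

(* Coefficientwise form of [(1 + y) (1 + 2y) g' = (p + 2 + 2 (p + 1) y) g] for
   [g = (1 + y)^p (1 + 2y)]. *)
Lemma cbin_rec p c :
  c.+2%:R * cbin p c.+2 =
  (p%:R - 3 * c%:R - 1) * cbin p c.+1 + 2 * (p%:R + 1 - c%:R) * cbin p c.
Proof.
have e1 := binS_mul p c; have e2 := binS_mul p c.+1.
(* The absorption identity one index lower; at [c = 0] both sides vanish. *)
have e0 : c%:R * 'C(p, c)%:R =
    (p%:R - c%:R + 1) * (if c is c'.+1 then 'C(p, c')%:R else 0) :> rat.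
  case: (c) => [|c']; first by rewrite mul0r mulr0.
  by rewrite binS_mul -natr1; congr (_ * _); ring.
rewrite /cbin; case: c e0 e1 e2 => [|c] e0 e1 e2; move: e0 e1 e2; rewrite -!natr1;
  move: 'C(p, _)%:R ('C(p, _)%:R) ('C(p, _)%:R) => *; lra.
Qed.

Definition qcoef (p q n : nat) : rat := if (n <= q)%N then cbin p (q - n) else 0.

(** This is what [hsum_rec] requires at each [q], with [p = m - q]. For [n < q] it is Pascal's rule
    combined with [cbin_rec] at [c = q - n - 1]; [n = q] and [n = q + 1] are boundary cases. *)
Lemma qcoef_rec p q n :
  4 * q%:R * qcoef p.+1 q n + q.+1%:R * qcoef p q.+1 n =
  n%:R * qcoef p q.+1 n + (3 * n%:R + p%:R + q%:R + 2) * qcoef p q n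
  + 2 * (n%:R + p%:R + q%:R + 2) * qcoef p q n.+1.
Proof.
rewrite /qcoef; case: (ltngtP n q) => [lt_nq|lt_qn|->].
- have [c ->] : exists c, q = (c + n).+1 by exists (q - n.+1)%N; lia.
  have -> : (n <= (c + n).+2)%N by lia.
  have -> : ((c + n).+2 - n = c.+2)%N by lia.
  have -> : ((c + n).+1 - n.+1 = c)%N by lia.
  have -> : ((c + n).+1 - n = c.+1)%N by lia.
  by have := cbin_rec p c; rewrite cbinS -!natr1 natrD; lra.
- have [->|ne] := eqVneq n q.+1.
    by rewrite leqnn subnn ?ltnn cbin0; ring.
  have -> : (n <= q.+1)%N = false by lia.
  by ring.
- by rewrite leqnSn subSnn subnn !cbin0 cbin1 -natr1; ring.
Qed.

(* [n`!] times the right-hand side of the theorem for [k = m - n], with the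
   summation index [j] replaced by [q = n + j]. *)
Definition hsum m n : rat :=
  \sum_(q < m.+1) (q`! * stirling2 m q)%:R * (2 ^+ (m + n) / 4 ^+ q) * qcoef (m - q) q n.

Lemma stirling2_gt m q : (m < q)%N -> stirling2 m q = 0%N.
Proof.
elim: m q => [|m IHm] [|q] //= lt_mq.
by rewrite !IHm ?muln0 // ltnW.
Qed.

(** The recurrence of the surjection numbers is transposed onto [F], so that identities between such
    sums can be checked separately for each [q]. *)
Lemma surj_sum_rec m (F : nat -> rat) :
  \sum_(q < m.+2) (q`! * stirling2 m.+1 q)%:R * F q =
  \sum_(q < m.+1) (q`! * stirling2 m q)%:R * (q%:R * F q + q.+1%:R * F q.+1).
Proof.
under [RHS]eq_bigr do rewrite mulrDr.
rewrite [RHS]big_split /= [X in _ = X + _]big_ord_recl mul0r mulr0 add0r.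
rewrite [LHS]big_ord_recl /= mul0r add0r.
under eq_bigr => q _ do
  rewrite /bump leq0n add1n mulnDr natrD mulrDl.
rewrite big_split /= big_ord_recr /= stirling2_gt // !muln0 mul0r addr0.
congr (_ + _); apply: eq_bigr => q _; rewrite /bump ?leq0n ?add1n ?factS !natrM; ring.
Qed.

(** The recurrence for V at [k = m + 1 - n], multiplied by [n!]; its factor [m - k + 2 = n + 1] is
    absorbed into [(n + 1)!]. At [n = 0] the truncated [n.-1] comes with coefficient 0. *)
Lemma hsum_rec m n :
  2 * hsum m.+1 n = 2 * n%:R * hsum m n.-1
    + (3 * n%:R + m%:R + 2) * hsum m n + (n%:R + m%:R + 2) * hsum m n.+1.
Proof.
rewrite /hsum; under eq_bigr do rewrite -mulrA.
rewrite (surj_sum_rec m (fun q => 2 ^+ (m.+1 + n) / 4 ^+ q * qcoef (m.+1 - q) q n)).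
rewrite !mulr_sumr -!big_split /=; apply: eq_bigr => q _.
have le_qm : (q <= m)%N by rewrite -ltnS.
rewrite subSS subSn //.
have := qcoef_rec (m - q) q n; rewrite natrB // => e2.
(* For fixed [p], [qcoef] depends on [q - n] only, so [n - 1] at [q] can be traded for [n] at
   [q + 1]. *)
have e1 : 2 * n%:R * (2 ^+ (m + n.-1) * qcoef (m - q) q n.-1) =
    2 ^+ (m + n) * (n%:R * qcoef (m - q) q.+1 n) :> rat.
  case: n {e2} => [|n]; first by ring.
  by rewrite /= addnS exprS /qcoef ltnS subSS; ring.
set t := (_`! * _)%:R.
have -> : 2 * n%:R * (t * (2 ^+ (m + n.-1) / 4 ^+ q) * qcoef (m - q) q n.-1) =
  t / 4 ^+ q * (2 ^+ (m + n) * (n%:R * qcoef (m - q) q.+1 n)).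
  by rewrite -e1; ring.
rewrite addSn addnS !exprS.
have -> : (4 * 4 ^+ q)^-1 = 4^-1 * (4 ^+ q)^-1 :> rat by rewrite invfM.
have -> : n%:R * qcoef (m - q) q.+1 n = 4 * q%:R * qcoef (m - q).+1 q n
   + q.+1%:R * qcoef (m - q) q.+1 n
   - (3 * n%:R + m%:R + 2) * qcoef (m - q) q n
   - 2 * (n%:R + m%:R + 2) * qcoef (m - q) q n.+1 by lra.
by field; rewrite expf_neq0.
Qed.

Lemma hsum_gt m n : (m < n)%N -> hsum m n = 0.
Proof.
move=> lt_mn; rewrite /hsum big1 // => q _; rewrite /qcoef leqNgt.
by rewrite (leq_trans _ lt_mn) ?mulr0.
Qed.

Lemma vsum_hsum m n : (n <= m)%N -> n`!%:R * vsum m (m - n) 1 0 = hsum m n.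
Proof.
elim: m n => [|m IHm] n.
  case: n => // _; rewrite subnn vsum0 /hsum big_ord1 /qcoef leqnn subnn cbin0.
  by rewrite addn0 !expr0 divr1 ?mulr1.
have two0 : 2 != 0 :> rat by [].
rewrite leq_eqVlt => /predU1P[->|]; last rewrite ltnS => le_nm.
  apply: (mulfI two0); rewrite hsum_rec /= (@hsum_gt m m.+1) // (@hsum_gt m m.+2) // -IHm // !subnn !vsum0.
  by rewrite factS natrM; ring.
apply: (mulfI two0); rewrite hsum_rec -(IHm n) //.
(* For [n = 0] the right side asks for [m + 1] letters in a word of length [m], so both sides
   vanish. *)
have -> : 2 * n%:R * hsum m n.-1 = 2 * n`!%:R * vsum m (m.+1 - n) 1 0.
  case: n le_nm => [|n] le_nm; first by rewrite mulr0 mul0r vsum_gt ?mulr0.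
  by rewrite -IHm 1?ltnW // factS natrM subSS; ring.
(* For [n = m] there is one letter only, and [vsum10_rec1] replaces [vsum10_rec]. *)
move: le_nm; rewrite leq_eqVlt => /predU1P[->|lt_nm].
  rewrite (@hsum_gt m m.+1) // subSn // subnn mulrCA vsum10_rec1 vsum0; ring.
rewrite -IHm // factS subSn; last exact: ltnW.
have [k e] : exists k, (m = k + n.+1)%N by exists (m - n.+1)%N; lia.
have -> : (m - n = k.+1)%N by lia.
have -> : (m - n.+1 = k)%N by lia.
rewrite mulrCA vsum10_rec natrM.
have -> : m%:R = k%:R + n%:R + 1 :> rat by rewrite e addnS -natr1 natrD.
rewrite -natr1; ring.
Qed.

(** * Extended binomial coefficients and Stirling numbers *)

Lemma ffact_nat (a j : nat) : ffact a%:R j = (a ^_ j)%:R.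
Proof.
rewrite /ffact; elim: j => [|j IHj]; first by rewrite big_ord0.
rewrite big_ord_recr /= IHj ffactnSr natrM.
have [le_ja|lt_aj] := leqP j a; first by rewrite natrB.
by rewrite ffact_small ?mul0r.
Qed.

Lemma binomZ_nat (a b : nat) : binomZ a%:Z b%:Z = 'C(a, b)%:R.
Proof.
rewrite /binomZ /= -pmulrn ffact_nat -bin_ffact natrM mulfK //.
by rewrite pnatr_eq0 -lt0n fact_gt0.
Qed.

(** Pascal's rule; at [j = 0] the lower index -1 gives 0 because the upper index is nonnegative. *)
Lemma binomZ_sum (p j : nat) :
  binomZ p%:Z (j%:Z - 1) + binomZ (p%:Z + 1) j%:Z = cbin p j.
Proof.
rewrite -[p%:Z + 1]/((p + 1)%N%:Z) addn1 binomZ_nat /cbin.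
case: j => [|j]; first by rewrite /binomZ /= !bin0; ring.
have -> : j.+1%:Z - 1 = j%:Z by lia.
by rewrite binomZ_nat binS natrD; ring.
Qed.

(** The polynomial [(1 + y)^p (1 + 2y)] has degree [p + 1]. *)
Lemma cbin_small p j : (p.+1 < j)%N -> cbin p j = 0.
Proof.
case: j => // j lt_pj; rewrite /cbin (bin_small (ltnW lt_pj)) (bin_small (lt_pj : p < j)%N); ring.
Qed.

(** If [m - k + j] is nonnegative, it is less than [j] and the falling factorial has a zero factor.
    If it is negative, the Stirling number vanishes: by opposite signs when [m > 0], as a first-kind
    number with lower index 0 when [m = 0]. *)
Lemma ffact_stirling2Z_eq0 (m k j : nat) : (m < k)%N ->
  ffact (m%:Z - k%:Z + j%:Z)%:~R j * stirling2Z m%:Z (m%:Z - k%:Z + j%:Z) = 0.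
Proof.
move=> lt_mk.
have [le_kmj|lt_mjk] := leqP k (m + j).
  have -> : m%:Z - k%:Z + j%:Z = (m + j - k)%N%:Z by lia.
  by rewrite -pmulrn ffact_nat ffact_small ?mul0r //; lia.
have [q def_q] : exists q : int, q = m%:Z - k%:Z + j%:Z by eexists.
rewrite -def_q.
rewrite /stirling2Z; have -> : (0 <= q) = false by lia.
rewrite andbF; case: m lt_mk lt_mjk def_q => [|m] *; last by rewrite mulr0.
have -> : q <= 0 by lia.
have -> : `|q|%N = (k - j).-1.+1 by lia.
by rewrite /= mulr0.
Qed.

(** Here [n! (n+j)_j = (n+j)!], and the exponents of 2 agree since [2n + k - 2(n + j) = k - 2j],
    which may be negative. *)
Lemma hsum_term (n k j : nat) : (j <= k)%N ->
  n`!%:R * (ffact (n + j)%:R j * (stirling2 (n + k) (n + j))%:R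
     * (2 : rat) ^ (k%:Z - (2 * j)%N%:Z) * cbin (k - j) j) =
  ((n + j)`! * stirling2 (n + k) (n + j))%:R
     * (2 ^+ (n + k + n) / 4 ^+ (n + j)) * cbin (k - j) j.
Proof.
move=> le_jk; rewrite ffact_nat -(ffact_fact (leq_addl n j)) addnK !natrM.
rewrite expfzDr // -exprnP -exprnN.
have -> : 4 = 2 ^+ 2 :> rat by [].
rewrite -exprM mulnDr (mul2n n) -addnn; move: (2 * j)%N => e; rewrite !exprD.
have : (2 : rat) ^+ n != 0 by rewrite expf_neq0.
have : (2 : rat) ^+ e != 0 by rewrite expf_neq0.
move: (2 ^+ n : rat) (2 ^+ e : rat) (2 ^+ k : rat) => a b c b0 a0.
by field; rewrite b0.
Qed.

Lemma vsum_closed m k :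
  vsum m k 1 0 =
  \sum_(0 <= j < (uphalf k).+1)
     ffact (m%:Z - k%:Z + j%:Z)%:~R j
     * stirling2Z m%:Z (m%:Z - k%:Z + j%:Z)
     * ((2 : rat) ^ (k%:Z - (2 * j)%N%:Z))
     * (binomZ (k%:Z - j%:Z) (j%:Z - 1) + binomZ (k%:Z - j%:Z + 1) j%:Z).
Proof.
have le_jk j : (j <= uphalf k)%N -> (j <= k)%N by lia.
have [lt_mk|le_km] := ltnP m k.
  rewrite vsum_gt // big_nat big1 // => j _.
  by rewrite ffact_stirling2Z_eq0 ?mul0r.
have [n ->] : exists n, m = (n + k)%N by exists (m - k)%N; lia.
apply: (@mulfI _ n`!%:R); first by rewrite pnatr_eq0 -lt0n fact_gt0.
rewrite -{2}(addKn n k) vsum_hsum ?leq_addr // /hsum.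
rewrite -(big_mkord predT (fun q => ((q`! * stirling2 (n + k) q)%:R
  * (2 ^+ (n + k + n) / 4 ^+ q) * qcoef (n + k - q) q n))).
rewrite (big_cat_nat (n := n)) //=; last by rewrite leqW ?leq_addr.
rewrite big_nat big1 ?add0r; last first.
  by move=> q /= lt_qn; rewrite /qcoef leqNgt lt_qn mulr0.
rewrite -{1}[n]add0n big_addn -addnS addKn.
(* Beyond [uphalf k] one has [j > k - j + 1], so [cbin_small] applies; this is the source of the
   upper bound of the sum. *)
rewrite (big_cat_nat (n := (uphalf k).+1)) //=; last by lia.
rewrite [X in _ + X]big_nat [X in _ + X]big1 ?addr0; last first.
  move=> j /andP[lt_uj lt_jk]; rewrite /qcoef leq_addl addnK cbin_small ?mulr0 //; lia.
rewrite mulr_sumr; apply: eq_big_nat => j /andP[_]; rewrite ltnS => /le_jk {}le_jk.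
have -> : (n + k)%N%:Z - k%:Z + j%:Z = (n + j)%N%:Z by lia.
have -> : k%:Z - j%:Z = (k - j)%N%:Z by lia.
rewrite binomZ_sum -pmulrn /stirling2Z /= hsum_term // /qcoef leq_addl addnK.
by rewrite [(j + n)%N]addnC subnDl.
Qed.

(** * Counting placements *)

(* [Some true], [Some false] and [None] are the letters L, R and N. *)
Definition word m := {ffun 'I_m -> option bool}.

Definition wcons m (c : option bool) (w : word m) : word m.+1 :=
  [ffun i => oapp w c (unlift ord0 i)].

Lemma wcons0 m c (w : word m) : wcons c w ord0 = c.
Proof. by rewrite ffunE unlift_none. Qed.

Lemma wconsS m c (w : word m) i : wcons c w (lift ord0 i) = w i.
Proof. by rewrite ffunE liftK. Qed.

Lemma big_word (R : nmodType) m (P : pred (word m.+1)) (F : word m.+1 -> R) :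
  \sum_(w | P w) F w =
  \sum_(w | P (wcons None w)) F (wcons None w)
  + \sum_(w | P (wcons (Some true) w)) F (wcons (Some true) w)
  + \sum_(w | P (wcons (Some false) w)) F (wcons (Some false) w).
Proof.
rewrite (reindex (fun p : option bool * word m => wcons p.1 p.2)) /=; last first.
  exists (fun w : word m.+1 => (w ord0, [ffun i => w (lift ord0 i)])).
    move=> [c w] _ /=; rewrite wcons0; congr pair.
    by apply/ffunP=> i; rewrite ffunE wconsS.
  move=> w _ /=; apply/ffunP=> i; case: (unliftP ord0 i) => [j|] ->.
    by rewrite wconsS ffunE.
  by rewrite wcons0.
rewrite -(pair_big_dep predT (fun c w => P (wcons c w)) (fun c w => F (wcons c w))) /=.
rewrite (bigD1 None) //= (bigD1 (Some true)) //= (bigD1 (Some false)) //=.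
rewrite !addrA [X in _ + X]big_pred0 ?addr0 //.
by case=> [[]|].
Qed.

Definition nletter m (b : bool) (w : word m) := (\sum_i (w i == Some b))%N.

Definition letter_weight m (x y : nat) (w : word m) (i : 'I_m) : nat :=
  match w i with
  | Some true => (x + \sum_(j < m | j < i) (w j != Some true))%N
  | Some false => (y + \sum_(j < m | i < j) (w j != Some false))%N
  | None => 1
  end.

Definition word_weight m x y (w : word m) := (\prod_i letter_weight x y w i)%N.

Lemma nletter_wcons m b c (w : word m) :
  nletter b (wcons c w) = ((c == Some b) + nletter b w)%N.
Proof.
rewrite /nletter big_ord_recl wcons0; congr addn.
by apply: eq_bigr => i _; rewrite wconsS.
Qed.

Lemma sum_neq_letter m b (w : word m) :
  (\sum_i (w i != Some b))%:R = m%:R - (nletter b w)%:R :> rat.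
Proof.
apply/eqP; rewrite eq_sym subr_eq -natrD -big_split /=.
rewrite (eq_bigr (fun=> 1%N)); last by move=> i _; case: eqP.
by rewrite sum1_card card_ord.
Qed.

(** A letter put in front is earlier than all others: unless it is an L, it adds one to every L, and
    it leaves every R unchanged. *)
Lemma word_weight_wcons m x y c (w : word m) :
  word_weight x y (wcons c w) =
  (match c with
   | Some true => x
   | Some false => y + \sum_i (w i != Some false)
   | None => 1
   end * word_weight (x + (c != Some true)) y w)%N.
Proof.
rewrite /word_weight big_ord_recl; congr muln.
  rewrite /letter_weight wcons0; case: c => [[]|] //.
    by rewrite big_pred0 ?addn0.
  congr addn; rewrite big_mkcond big_ord_recl /= add0n.
  by apply: eq_bigr => i _; rewrite wconsS.
apply: eq_bigr => i _; rewrite /letter_weight wconsS; case: (w i) => [[]|] //.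
  rewrite -addnA; congr addn; rewrite big_mkcond big_ord_recl wcons0 /=; congr addn.
  rewrite [RHS]big_mkcond; apply: eq_bigr => j _.
  by rewrite wconsS /= /bump !leq0n !add1n ltnS.
congr addn; rewrite big_mkcond big_ord_recl /= add0n.
rewrite [RHS]big_mkcond; apply: eq_bigr => j _.
by rewrite wconsS /= /bump !leq0n !add1n ltnS.
Qed.

Lemma sum_word_weight m l r x y :
  \sum_(w : word m | (nletter true w == l) && (nletter false w == r))
     (word_weight x y w)%:R = wsum m l r x%:R y%:R.
Proof.
elim: m l r x y => [|m IHm] l r x y.
  have nl0 b (w : word 0) : nletter b w = 0%N by rewrite /nletter big_ord0.
  rewrite wsum_nil; under eq_bigl do rewrite !nl0 ![(0 == _)%N]eq_sym.
  under eq_bigr do rewrite /word_weight big_ord0.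
  case: (_ && _); last by rewrite big_pred0.
  by rewrite sumr_const card_ffun card_ord expn0.
rewrite big_word wsum_first; congr (_ + _ + _).
- rewrite natr1 -(addn1 x) -IHm; apply: eq_big => w; rewrite !nletter_wcons //.
  by rewrite word_weight_wcons mul1n.
- case: l => [|l].
    by rewrite big_pred0 // => w; rewrite nletter_wcons.
  rewrite -IHm mulr_sumr; apply: eq_big => w; rewrite !nletter_wcons //.
  by rewrite word_weight_wcons addn0 natrM.
- case: r => [|r].
    by rewrite big_pred0 // => w; rewrite !nletter_wcons andbF.
  rewrite natr1 -(addn1 x) -IHm mulr_sumr; apply: eq_big => w; rewrite !nletter_wcons //.
  move=> /andP[_ /eqP [<-]].
  by rewrite word_weight_wcons natrM natrD sum_neq_letter addrA.
Qed.

Lemma subz_eq (a b c d : nat) : a%:Z - b%:Z = c%:Z - d%:Z -> (a + d = c + b)%N.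
Proof. lia. Qed.

Section Placements.
Variable m : nat.
Implicit Types (P : {set 'I_m * 'I_m}) (w : word m) (x y : 'I_m * 'I_m).
Local Open Scope nat_scope.

Definition side x : bool := x.2 <= x.1.

(** The diagonal condition is put additively, to avoid truncated subtraction. *)
Lemma nonattackingP P :
  reflect ({in P &, forall x y, x.1 = y.1 \/ x.1 + y.2 = y.1 + x.2 -> x = y})
          (nonattacking P).
Proof.
apply: (iffP forall_inP) => [naP x y xP yP exy | naP x xP].
  apply/eqP; move/forall_inP: (naP x xP) => /(_ y yP).
  case: eqP => //= _ /andP[/eqP ne1 /eqP ne2]; case: exy => // exy.
  by case: ne2; lia.
apply/forall_inP=> y yP; apply/implyP=> /eqP nxy; apply/andP; split.
  by apply/eqP=> e1; apply: nxy; apply: naP => //; left.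
apply/eqP=> e1; apply: nxy; apply: naP => //; right.
exact: subz_eq e1.
Qed.

Lemma nonattackingS P1 P2 : P1 \subset P2 -> nonattacking P2 -> nonattacking P1.
Proof.
move=> /subsetP sP12 /nonattackingP naP; apply/nonattackingP=> x y xP yP.
by apply: naP; apply: sP12.
Qed.

(* On a nonattacking [P] a row holds at most one cell, so the [pick] is no choice. *)
Definition rowtype P : word m :=
  [ffun i => omap side [pick x in P | x.1 == i]].

Lemma rowtypeP P i b : nonattacking P ->
  reflect (exists2 x, x \in P & x.1 = i /\ side x = b) (rowtype P i == Some b).
Proof.
move=> /nonattackingP naP; rewrite ffunE.
case: pickP => [x /andP[xP /eqP xi] | noP] /=.
  apply: (iffP eqP) => [[<-] | [y yP [yi <-]]]; first by exists x.
  by rewrite (naP x y) //; left; rewrite xi.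
by right=> -[y yP [yi _]]; have := noP y; rewrite yP yi eqxx.
Qed.

Lemma rowtype_None P i x : rowtype P i = None -> x \in P -> x.1 != i.
Proof.
rewrite ffunE; case: pickP => // noP _ xP.
by have := noP x; rewrite xP /= => ->.
Qed.

Lemma rowtype_eq P w : nonattacking P ->
  (forall i b, w i = Some b <-> exists2 x, x \in P & x.1 = i /\ side x = b) ->
  rowtype P = w.
Proof.
move=> naP wP; apply/ffunP=> i.
case Ew: (w i) => [b|]; first by apply/eqP/rowtypeP => //; apply/wP.
case Er: (rowtype P i) => [b|] //.
by have /wP := elimT (rowtypeP i b naP) (introT eqP Er); rewrite Ew.
Qed.

Definition placements w := [set P | nonattacking P && (rowtype P == w)].

Lemma card_side P b : nonattacking P ->
  #|[set x in P | side x == b]| = nletter b (rowtype P).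
Proof.
move=> naP; rewrite /nletter -big_mkcond /= sum1dep_card.
have inj1 : {in [set x in P | side x == b] &, injective (fun x => x.1)}.
  move=> x y; rewrite !inE => /andP[xP _] /andP[yP _] e.
  by move/nonattackingP: naP; apply=> //; left.
rewrite -(card_in_imset inj1); apply: eq_card => i.
rewrite !inE; apply/imsetP/idP => [[x] | /rowtypeP [] // x xP [<- <-]].
  by rewrite inE => /andP[xP /eqP <-] ->; apply/rowtypeP => //; exists x.
by exists x => //; rewrite inE xP eqxx.
Qed.

Lemma card_nonattacking P : nonattacking P ->
  #|P| = nletter true (rowtype P) + nletter false (rowtype P).
Proof.
move=> naP; rewrite -!card_side // -(cardsID [set x | side x]).
by congr addn; apply: eq_card => x; rewrite !inE; case: (side x); rewrite ?andbT ?andbF.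
Qed.

Definition erase w i : word m := [ffun j => if j == i then None else w j].

(* Among the rows of its type, [i] is the one whose allowed diagonals contain
   those of all the others. *)
Definition outermost w i b :=
  w i = Some b /\ forall j, w j = Some b -> if b then j <= i else i <= j.

Definition free_cells (i : 'I_m) b P :=
  [set j : 'I_m | ((j <= i) == b) && [forall x in P, i + x.2 != x.1 + j]].

(** Row [i] has one L cell for each earlier row and one on the main diagonal, and one R cell for
    each later row; hence the parameters 1 and 0. As [i] is outermost, all other rows of type [b]
    are among these, and the remaining ones make up the weight. *)
Lemma letter_weight_outermost w i b : outermost w i b ->
  letter_weight 1 0 w i + nletter b (erase w i) = \sum_(j < m) ((j <= i) == b).
Proof.
case=> wi max_i; rewrite /letter_weight wi /nletter.
case: b wi max_i => wi max_i; last rewrite add0n.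
  rewrite -[X in X + _ + _](_ : \sum_(j < m) (j == i) = 1); last first.
    by rewrite -big_mkcond /= sum1_card card1.
  rewrite [\sum_(j < m | j < i) _]big_mkcond -!big_split /=; apply: eq_bigr => j _.
  rewrite ffunE; case: (eqVneq j i) => [->|ji]; first by rewrite ltnn leqnn.
  case: (eqVneq (w j) (Some true)) => [/max_i le_ji|].
    by move: (ji : (j : nat) != i) le_ji; case: (ltngtP j i).
  by move: (ji : (j : nat) != i); case: (ltngtP j i).
rewrite [\sum_(j < m | i < j) _]big_mkcond -!big_split /=; apply: eq_bigr => j _.
rewrite ffunE; case: (eqVneq j i) => [->|ji]; first by rewrite ltnn leqnn.
case: (eqVneq (w j) (Some false)) => [/max_i le_ij|].
  by move: (ji : (j : nat) != i) le_ij; case: (ltngtP j i).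
by move: (ji : (j : nat) != i); case: (ltngtP j i).
Qed.

(** Each piece of [P] on side [b] blocks exactly one cell of that side in row [i], distinct pieces
    block distinct cells, and pieces of the other side block none. *)
Lemma card_free_cells w i b P : outermost w i b -> P \in placements (erase w i) ->
  #|free_cells i b P| = letter_weight 1 0 w i.
Proof.
move=> out_i; rewrite inE => /andP[naP /eqP rP].
have [wi max_i] := out_i.
apply/eqP; rewrite -(eqn_add2r (nletter b (erase w i))) letter_weight_outermost //.
rewrite -rP -card_side //; set U := [set x in P | _].
have UP x : x \in U -> [/\ x \in P, side x = b & if b then x.1 < i else i < x.1].
  rewrite inE => /andP[xP /eqP sx]; split=> //.
  have : rowtype P x.1 == Some b by apply/rowtypeP => //; exists x.
  rewrite rP ffunE; case: (eqVneq x.1 i) => // xi /eqP wx; have := max_i _ wx.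
  by move: (xi : (x.1 : nat) != i); case: (b); case: (ltngtP x.1 i).
(* The column in which the diagonal of [x] meets row [i]. For [x] in [U] it lies on the board, so
   the default of [insubd] is not reached. *)
pose phi x : 'I_m := insubd i (x.2 + i - x.1).
have phiE x : x \in U -> phi x + x.1 = x.2 + i /\ (phi x <= i) = b.
  case/UP => _; rewrite /side /phi val_insubd => sx lt_x.
  have := ltn_ord x.2; have := ltn_ord i.
  by case: (b) sx lt_x; case: ifP; lia.
have inj_phi : {in U &, injective phi}.
  move=> x y xU yU e; have [ex _] := phiE x xU; have [ey _] := phiE y yU.
  have [xP _ _] := UP x xU; have [yP _ _] := UP y yU.
  by move/nonattackingP: naP; apply=> //; right; rewrite e in ex; lia.
rewrite -(card_in_imset inj_phi) -[X in _ == X]big_mkcond /= sum1dep_card.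
rewrite -(cardsID [set phi x | x in U] [set j : 'I_m | (j <= i) == b]).
rewrite addnC.
apply/eqP; congr addn; apply: eq_card => j; rewrite !inE.
  apply/idP/andP=> [|[]//] jU; split=> //.
  by case/imsetP: jU => x /phiE [_ e] ->; rewrite e.
rewrite [RHS]andbC; case: eqP => //= sj; apply/forall_inP/negP => [fr /imsetP[x xU ex]|nU x xP].
  by have [xP _ _] := UP x xU; have [e _] := phiE x xU; have := fr x xP; rewrite ex; lia.
apply/eqP=> e; apply: nU; apply/imsetP; exists x.
  by rewrite inE xP /side -sj; lia.
apply: val_inj => /=; rewrite /phi val_insubd; have := ltn_ord j; case: ifP; lia.
Qed.

(** Fill row [i] last: the number of free cells is the same for every placement of the other
    rows. *)
Lemma card_placements_erase w i b : outermost w i b ->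
  #|placements w| = #|placements (erase w i)| * letter_weight 1 0 w i.
Proof.
move=> out_i; have [wi _] := out_i.
pose Y := [set p : {set 'I_m * 'I_m} * 'I_m |
  (p.1 \in placements (erase w i)) && (p.2 \in free_cells i b p.1)].
pose add_cell (p : {set 'I_m * 'I_m} * 'I_m) := (i, p.2) |: p.1.
have YP Q j : (Q, j) \in Y -> [/\ nonattacking Q, rowtype Q = erase w i,
    forall x, x \in Q -> x.1 != i, (j <= i) = b &
    forall x, x \in Q -> i + x.2 <> x.1 + j].
  rewrite !inE /= => /andP[/andP[naQ /eqP rQ] /andP[/eqP sj /forall_inP fr]].
  split=> //; last by move=> x /fr /eqP.
  by move=> x; apply: rowtype_None; rewrite rQ ffunE eqxx.
have inj_add : {in Y &, injective add_cell}.
  move=> [Q j] [Q' j'] /YP[_ _ noQ _ _] /YP[_ _ noQ' _ _]; rewrite /add_cell /= => e.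
  have : (i, j) \in (i, j') |: Q' by rewrite -e setU11.
  rewrite in_setU1 => /predU1P[[ej]|/noQ']; last by rewrite eqxx.
  congr pair => //; rewrite -ej in e; apply/setP=> x.
  have /setP/(_ x) := e; rewrite !in_setU1.
  case: eqVneq => [->|//] _; apply/idP/idP; [move/noQ | move/noQ']; by rewrite eqxx.
have <- : #|Y| = #|placements (erase w i)| * letter_weight 1 0 w i.
  rewrite -sum1_card (eq_bigl (fun p : {set 'I_m * 'I_m} * 'I_m =>
    (p.1 \in placements (erase w i)) && (p.2 \in free_cells i b p.1))); last first.
    by move=> p; rewrite inE.
  rewrite -(pair_big_dep (mem (placements (erase w i)))
    (fun Q j => j \in free_cells i b Q) (fun _ _ => 1)) /=.
  rewrite -sum_nat_const; apply: eq_bigr => Q QP.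
  by rewrite sum1_card (card_free_cells out_i).
rewrite -(card_in_imset inj_add); apply: eq_card => P.
apply/idP/imsetP => [|[[Q j] QY ->]].
  rewrite inE => /andP[naP /eqP rP]; have naP' := elimT (nonattackingP P) naP.
  have /rowtypeP[//|x xP [xi sx]] : rowtype P i == Some b by rewrite rP wi.
  have Px : (i, x.2) |: (P :\ x) = P by rewrite -xi -surjective_pairing setD1K.
  have naPx : nonattacking (P :\ x) := nonattackingS (subsetDl _ _) naP.
  exists (P :\ x, x.2); rewrite // inE /= inE naPx inE.
  have -> : (x.2 <= i) = b by rewrite -sx /side xi.
  rewrite eqxx /=; apply/andP; split.
    apply/eqP/rowtype_eq => // j c; rewrite ffunE; split.
      case: eqVneq => // ji wj.
      have /rowtypeP[//|y yP [yj sy]] : rowtype P j == Some c by rewrite rP wj.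
      exists y => //; rewrite !inE yP andbT; apply/eqP=> yx.
      by move: ji; rewrite -yj yx xi eqxx.
    case=> y; rewrite !inE => /andP[yx yP] [yj sy].
    case: eqVneq => [ji|_].
      by case/eqP: yx; apply: naP' => //; left; rewrite xi yj.
    by apply/eqP; rewrite -rP; apply/rowtypeP => //; exists y.
  apply/forall_inP=> y; rewrite !inE => /andP[yx yP]; apply/eqP=> e.
  by case/eqP: yx; apply: naP' => //; right; rewrite xi; lia.
have [naQ rQ noQ sj fr] := YP _ _ QY; rewrite /add_cell /= inE.
have naP : nonattacking ((i, j) |: Q).
  apply/nonattackingP=> x y; rewrite !in_setU1.
  case/predU1P => [->|xQ]; case/predU1P => [->|yQ] //=.
  - case=> [e|e]; first by have := noQ y yQ; rewrite -e eqxx.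
    by case: (fr y yQ).
  - case=> [e|e]; first by have := noQ x xQ; rewrite e eqxx.
    by case: (fr x xQ).
  by apply: (elimT (nonattackingP Q) naQ).
rewrite naP /=; apply/eqP/rowtype_eq => // k c; split.
  case: (eqVneq k i) => [->|ki wk].
    by rewrite wi => -[<-]; exists (i, j); rewrite ?setU11.
  have /rowtypeP[//|y yQ yP] : rowtype Q k == Some c by rewrite rQ ffunE (negPf ki) wk.
  by exists y => //; rewrite in_setU1 yQ orbT.
case=> y; rewrite in_setU1 => /predU1P[->|yQ] [yk sy].
  by rewrite -yk /= wi -sy /side sj.
have /rowtypeP/eqP : exists2 y, y \in Q & y.1 = k /\ side y = c by exists y.
move=> /(_ naQ); rewrite rQ ffunE; case: eqP => // _; exact.
Qed.

(** Only letters equal to [w i] could notice the change to N: an L after [i] or an R before [i].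
    There is none, since [i] is the last L or the first R. *)
Lemma word_weight_erase w i b : outermost w i b ->
  word_weight 1 0 w = word_weight 1 0 (erase w i) * letter_weight 1 0 w i.
Proof.
case=> wi max_i; rewrite /word_weight (bigD1 i) //= mulnC; congr muln.
rewrite [RHS](bigD1 i) //= {2}/letter_weight ffunE eqxx mul1n.
apply: eq_bigr => j ji; rewrite /letter_weight ffunE (negPf ji).
case wj: (w j) => [[]|] //; congr addn; apply: eq_bigr => k lt_k;
  rewrite ffunE; case: (eqVneq k i) => // ki; rewrite {}ki in lt_k *; rewrite wi.
  by case: b wi max_i => // _ /(_ j wj); rewrite leqNgt lt_k.
by case: b wi max_i => // _ /(_ j wj); rewrite leqNgt lt_k.
Qed.

(** Induction on the number of letters other than N, erasing the last L or, without L, the first R.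
    The word of N only leaves the empty placement. *)
Lemma card_placements w : #|placements w| = word_weight 1 0 w.
Proof.
have [n] := ubnP (nletter true w + nletter false w).
elim: n w => // n IHn w; rewrite ltnS => le_n.
have step i b : outermost w i b -> #|placements w| = word_weight 1 0 w.
  move=> out_i; have [wi _] := out_i.
  rewrite (card_placements_erase out_i) (word_weight_erase out_i) IHn //.
  apply: leq_trans le_n; rewrite /nletter -!big_split /=.
  rewrite [in X in X < _](bigD1 i) //= [in X in _ < X](bigD1 i) //= ffunE eqxx wi.
  rewrite add0n -add1n leq_add //; first by case: (b).
  by apply: leq_sum => j ji; rewrite ffunE (negPf ji).
have [i0 /eqP w_i0|noL] := pickP (fun i => w i == Some true).
  apply: (step [arg max_(i > i0 | w i == Some true) (i : nat)] true).
  case: arg_maxnP => [|i /eqP wi max_i]; first exact/eqP.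
  by split=> // j /eqP /max_i.
have [i0 /eqP w_i0|noR] := pickP (fun i => w i == Some false).
  apply: (step [arg min_(i < i0 | w i == Some false) (i : nat)] false).
  case: arg_minnP => [|i /eqP wi min_i]; first exact/eqP.
  by split=> // j /eqP /min_i.
have w0 i : w i = None by case E: (w i) (noL i) (noR i) => [[]|].
rewrite /word_weight big1 => [|i _]; last by rewrite /letter_weight w0.
apply/eqP/cards1P; exists set0; apply/setP=> P; rewrite !inE.
apply/andP/eqP => [[_ /eqP rP] | ->].
  apply/setP=> x; rewrite inE; apply/negP=> /(rowtype_None (i := x.1)).
  by rewrite rP w0 eqxx => /(_ erefl).
have na0 : nonattacking (set0 : {set 'I_m * 'I_m}).
  by apply/nonattackingP=> x y; rewrite inE.
split=> //; apply/eqP/rowtype_eq => // i b; rewrite w0; split=> //.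
by case=> x; rewrite inE.
Qed.

End Placements.

Lemma AS_vsum m k : (AS m k)%:R = vsum m k 1 0.
Proof.
rewrite /vsum; under eq_bigr do rewrite -(sum_word_weight _ _ _ 1 0).
have -> : AS m k = (\sum_(w : word m | nletter true w + nletter false w == k)
    word_weight 1 0 w)%N.
  rewrite /AS -sum1dep_card (partition_big (@rowtype m)
    (fun w => nletter true w + nletter false w == k)%N) /=; last first.
    by move=> P /andP[/eqP <- naP]; rewrite card_nonattacking.
  apply: eq_bigr => w /eqP wk; rewrite -card_placements sum1dep_card.
  apply: eq_card => P; rewrite !inE; case naP: (nonattacking P); last by rewrite andbF.
  by case: (rowtype P =P w) => [rP|]; rewrite ?andbF // card_nonattacking // rP wk eqxx.
rewrite natr_sum (partition_big (fun w => inord (nletter true w) : 'I_k.+1) predT) //=.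
apply: eq_bigr => l _; apply: eq_bigl => w; have := ltn_ord l.
(* With more than [k] letters L the value of [inord] is arbitrary, but then both conditions fail. *)
have [le_nk|lt_kn] := leqP (nletter true w) k.
  by rewrite -val_eqE /= inordK //; lia.
by move=> lt_lk; apply/idP/idP; lia.
Qed.

Theorem theorem3p2 (m k : nat) :
  (AS m k)%:R =
  \sum_(0 <= j < (uphalf k).+1)
     ffact (m%:Z - k%:Z + j%:Z)%:~R j
     * stirling2Z m%:Z (m%:Z - k%:Z + j%:Z)
     * ((2 : rat) ^ (k%:Z - (2 * j)%N%:Z))
     * (binomZ (k%:Z - j%:Z) (j%:Z - 1) + binomZ (k%:Z - j%:Z + 1) j%:Z) :> rat.
Proof. by rewrite AS_vsum vsum_closed. Qed.
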